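(* Let firm $k$ practice targeted advertising and assume $u_k^2+v_k^2=1$. Then the instantaneous rate of sales increase $\dot{s}_k$ of firm $k$, regarded as a function of $u_k$ (with $v_k=\sqrt{1-u_k^2}$ and all other quantities at the current instant held fixed), is maximized by the allocation $$u_k=\frac{\rho_kX}{\sqrt{\sigma_k^2(1-X)^2+\rho_k^2X^2}},$$ where $$X=\frac{1}{N}\sum_{\substack{j=1\\ j\ne k}}^n s_j,\qquad N=m-s_k .$$
   Context: There are $n\ge2$ firms with sales $s_1,\ldots,s_n>0$ in a market of fixed total size $m$; the market potential is $\varepsilon=m-\sum_{j=1}^n s_j\ge 0$. Firm $k$ has advertising effort $u_k\ge 0$ towards competitors' customers with effectiveness-to-effort ratio $\rho_k>0$, effort $v_k\ge 0$ towards the market potential with effectiveness-to-effort ratio $\sigma_k>0$, and cancellation rate $c_k\ge 0$. Firm $k$'s sales rate under targeted advertising satisfies $$\dot{s}_k=\sigma_kv_k\Big(m-\sum_{j=1}^ns_j\Big) +\rho_ku_k\sum_{\substack{j=1\\ j\ne k}}^ns_j -s_k\Big(c_k+\sum_{\substack{j=1\\ j\ne k}}^n\rho_ju_j\Big).$$ $N=m-s_k$ is the part of the market not held by firm $k$, and $X$ is the proportion of $N$ held by firm $k$'s competitors, so that $X=(N-\varepsilon)/N$. The constraint $u_k^2+v_k^2=1$ expresses a fixed advertising budget equal to $1$. *)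

(* Defs.v *)
From HB Require Import structures.
From mathcomp Require Import all_boot all_order all_algebra.

Set Implicit Arguments.
Unset Strict Implicit.
Unset Printing Implicit Defensive.

Import Order.TTheory GRing.Theory Num.Theory.
Local Open Scope ring_scope.

Definition market_potential (R : rcfType) (n : nat) (m : R) (s : 'I_n -> R) : R :=
  m - \sum_j s j.

(* The instantaneous rate of change of the sales of firm k, as prescribed by the
   targeted-advertising dynamics at the state s and the efforts u, v. *)
Definition sales_rate (R : rcfType) (n : nat) (m : R)
    (rho sigma c s u v : 'I_n -> R) (k : 'I_n) : R :=
  sigma k * v k * market_potential m s
  + rho k * u k * (\sum_(j < n | j != k) s j)
  - s k * (c k + \sum_(j < n | j != k) rho j * u j).

Definition not_held (R : rcfType) (n : nat) (m : R) (s : 'I_n -> R) (k : 'I_n) : R :=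
  m - s k.

Definition competitor_share (R : rcfType) (n : nat) (m : R) (s : 'I_n -> R)
    (k : 'I_n) : R :=
  (not_held m s k)^-1 * \sum_(j < n | j != k) s j.

Definition budget_effort (R : rcfType) (x : R) : R := Num.sqrt (1 - x ^+ 2).

(* Num.sqrt vanishes on negative numbers, so the last condition does rule out
   1 < x: the admissible efforts form the interval [0, 1]. *)
Definition admissible_effort (R : rcfType) (x : R) : Prop :=
  [/\ 0 <= x, 0 <= budget_effort x & x ^+ 2 + budget_effort x ^+ 2 = 1].

(* [eta u with k |-> x] replaces the k-th effort by x and keeps the others. *)
Definition sales_rate_of_effort (R : rcfType) (n : nat) (m : R)
    (rho sigma c s u v : 'I_n -> R) (k : 'I_n) (x : R) : R :=
  sales_rate m rho sigma c s
    [eta u with k |-> x] [eta v with k |-> budget_effort x] k.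

Definition maximized_at (R : rcfType) (D : R -> Prop) (f : R -> R) (x : R) : Prop :=
  D x /\ forall y, D y -> f y <= f x.

(* Main.v *)
(* On the quarter circle x^2 + w^2 = 1 the rate is N (a x + b w) plus a
   constant, with a = rho_k X and b = sigma_k (1 - X).  By Cauchy-Schwarz this is
   at most N sqrt (a^2 + b^2) plus that constant, with equality when (x, w) is
   proportional to (a, b). *)
Require Import Defs.
From HB Require Import structures.
From mathcomp Require Import all_boot all_order all_algebra.
From mathcomp Require Import ring.

Import Order.TTheory GRing.Theory Num.Theory.
Local Open Scope ring_scope.

(** By Lagrange's identity, the gap between the squares of the two sides is
    [(b * x - a * w) ^+ 2]. *)
Lemma cauchy_schwarz_unit (R : rcfType) (a b x w : R) :
  x ^+ 2 + w ^+ 2 = 1 -> b * w + a * x <= Num.sqrt (b ^+ 2 + a ^+ 2).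
Proof.
move=> xw1; apply: le_trans (ler_norm _) _.
rewrite -sqrtr_sqr ler_wsqrtr // -[leRHS]mulr1 -xw1 -subr_ge0.
have -> : (b ^+ 2 + a ^+ 2) * (x ^+ 2 + w ^+ 2) - (b * w + a * x) ^+ 2
  = (b * x - a * w) ^+ 2 by ring.
exact: sqr_ge0.
Qed.

(** The point of the unit circle in the direction of [(a, b)] attains the Cauchy-Schwarz bound; the
    signs of [a] and [b] place it on the admissible quarter. *)
Lemma linear_maximized_at (R : rcfType) (a b : R) : 0 < a -> 0 <= b ->
  maximized_at (@admissible_effort R) (fun x => b * budget_effort x + a * x)
    (a / Num.sqrt (b ^+ 2 + a ^+ 2)).
Proof.
move=> a_gt0 b_ge0; set r := Num.sqrt _.
have r_gt0 : 0 < r by rewrite sqrtr_gt0 ltr_wpDl ?sqr_ge0 ?exprn_gt0.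
have r_neq0 := lt0r_neq0 r_gt0.
have r2E : r ^+ 2 = b ^+ 2 + a ^+ 2 by rewrite sqr_sqrtr ?addr_ge0 ?sqr_ge0.
(* As [b / r] is nonnegative, it is the square root of its own square, which is
   [1 - (a / r) ^+ 2]. *)
have budgetE : budget_effort (a / r) = b / r.
  have br_ge0 : 0 <= b / r by rewrite divr_ge0 // ltW.
  rewrite -(ger0_norm br_ge0) -sqrtr_sqr /budget_effort; congr Num.sqrt.
  by apply: (mulIf (expf_neq0 2 r_neq0)); rewrite mulrBl -!exprMn !divfK // r2E; ring.
split.
  split; rewrite ?sqrtr_ge0 //; first by rewrite divr_ge0 // ltW.
  by rewrite budgetE !expr_div_n -mulrDl addrC -r2E divff ?expf_neq0.
move=> y [_ _ /cauchy_schwarz_unit leyr].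
(* The value at [a / r] is [(b ^+ 2 + a ^+ 2) / r = r], exactly the upper bound. *)
rewrite budgetE !mulrA -mulrDl -!expr2 -r2E expr2 mulfK //; exact: leyr.
Qed.

(** With at least two firms, some [j] differs from [k]. This positivity later gives both [N > 0] and
    [X > 0]. *)
Lemma competitors_sales_gt0 (R : numDomainType) (n : nat) (s : 'I_n -> R) (k : 'I_n) :
  (2 <= n)%N -> (forall j, 0 < s j) -> 0 < \sum_(j < n | j != k) s j.
Proof.
move=> n_ge2 s_gt0.
have /card_gt0P[j jk] : (0 < #|predC1 k|)%N.
  by rewrite cardC1 card_ord -subn1 subn_gt0.
rewrite (bigD1 j) //= ltr_wpDr // sumr_ge0 // => i _; exact: ltW.
Qed.

Lemma sales_rate_of_effortE (R : rcfType) (n : nat) (m : R)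
    (rho sigma c s u v : 'I_n -> R) (k : 'I_n) (x : R) :
  sales_rate_of_effort m rho sigma c s u v k x
  = sigma k * budget_effort x * market_potential m s
    + rho k * x * (\sum_(j < n | j != k) s j)
    - s k * (c k + \sum_(j < n | j != k) rho j * u j).
Proof.
rewrite /sales_rate_of_effort /sales_rate /= !eqxx.
(* The last sum runs over [j != k], so it never sees the effort replaced at [k]. *)
by do 3!congr (_ _); under eq_bigr => j /negPf-> do [].
Qed.

Theorem theorem4p1 (R : rcfType) (n : nat) (hn : (2 <= n)%N) (m : R)
    (rho sigma c s u v : 'I_n -> R)
    (hs : forall j, 0 < s j)
    (hm : 0 <= market_potential m s)
    (hrho : forall j, 0 < rho j)
    (hsigma : forall j, 0 < sigma j)
    (hc : forall j, 0 <= c j)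
    (hu : forall j, 0 <= u j)
    (hv : forall j, 0 <= v j)
    (k : 'I_n)
    (hbudget : u k ^+ 2 + v k ^+ 2 = 1) :
  let X := competitor_share m s k in
  maximized_at (@admissible_effort R)
    (sales_rate_of_effort m rho sigma c s u v k)
    (rho k * X / Num.sqrt (sigma k ^+ 2 * (1 - X) ^+ 2 + rho k ^+ 2 * X ^+ 2)).
Proof.
move=> X.
set P := \sum_(j < n | j != k) s j.
set e := market_potential m s.
have P_gt0 : 0 < P by exact: competitors_sales_gt0.
(* Customers outside firm [k] are either uncommitted or held by competitors; hence the fractions
   [1 - X] and [X] below. *)
have NE : not_held m s k = e + P.
  by rewrite /e /market_potential (bigD1 k) //= -/P /not_held; ring.
have N_gt0 : 0 < e + P by rewrite ltr_wpDl.
have N_neq0 := lt0r_neq0 N_gt0.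
have XE : X = P / (e + P) by rewrite /X /competitor_share NE mulrC.
have X1E : 1 - X = e / (e + P) by rewrite XE; field.
have a_gt0 : 0 < rho k * X by rewrite XE mulr_gt0 // divr_gt0.
have b_ge0 : 0 <= sigma k * (1 - X).
  by rewrite X1E; apply: mulr_ge0 (ltW (hsigma k)) (divr_ge0 hm (ltW N_gt0)).
rewrite -!exprMn.
have [adm le_max] := linear_maximized_at _ _ _ a_gt0 b_ge0.
(* Substituting [e = N (1 - X)] and [P = N X] pulls out the positive factor [N]; the subtracted term
   is constant in [x]. *)
have rateE x : sales_rate_of_effort m rho sigma c s u v k x
    = (e + P) * (sigma k * (1 - X) * budget_effort x + rho k * X * x)
      - s k * (c k + \sum_(j < n | j != k) rho j * u j).
  by rewrite sales_rate_of_effortE -/P -/e X1E XE; field.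
by split=> // y /le_max le_y; rewrite !rateE lerD2r ler_pM2l.
Qed.
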